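(* For any $\rho\in(0,0.5)$ and $\nu\in(0,0.5)$ such that $2\nu^2\le\rho\le\nu$, there exist ternary distributions $p$ and $q$ (distributions on a three-element set) such that $d_{\mathrm h}^2(p,q)=\rho$, $d_{\mathrm{TV}}(p,q)=\nu$, and for $\epsilon>0$ the sample complexity behaves as $$n^*(p,q,\epsilon)\asymp\begin{cases}\dfrac{1}{\epsilon^2\, d_{\mathrm{TV}}^2(p,q)}, & \text{if } \epsilon\le 1,\\[2mm] \min\left(\dfrac{1}{d_{\mathrm{TV}}^2(p,q)},\dfrac{1}{e^\epsilon\, d_{\mathrm h}^4(p,q)}\right), & \text{if } e^\epsilon\in\left[e,\dfrac{1}{d_{\mathrm h}^2(p,q)}\right],\\[2mm] \dfrac{1}{d_{\mathrm h}^2(p,q)}, & \text{if } e^\epsilon>\dfrac{1}{d_{\mathrm h}^2(p,q)}.\end{cases}$$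
   Context: $d_{\mathrm{TV}}(p,q)=\frac12\sum_i|p_i-q_i|$, $d_{\mathrm h}^2(p,q)=\sum_i(\sqrt{p_i}-\sqrt{q_i})^2$, and $d_{\mathrm h}^4=(d_{\mathrm h}^2)^2$. The notation $a\asymp b$ means $c_1 b\le a\le c_2 b$ for universal positive constants $c_1,c_2$. A channel $\mathbf T$ from $\mathcal X$ to a countable set $\mathcal Y$ is a transition kernel $\mathbf T(y,x)=\mathbb P(Y=y\mid X=x)$, also viewed as a stochastic map $Y=\mathbf T(X)$. It is $\epsilon$-LDP if $\mathbf T(y,x)\le e^\epsilon\,\mathbf T(y,x')$ for all $x,x'\in\mathcal X$, $y\in\mathcal Y$. Sample complexity $n^*(p,q,\epsilon)$: the smallest $n$ for which there exist a deterministic rule assigning to each user $i\in[n]$ an $\epsilon$-LDP channel $\mathbf T_i$ from $\mathcal X$ to $\mathbb N$, and a test $\phi$ with values in $\{p,q\}$, such that, when $X_1,\dots,X_n$ are i.i.d. and $Y_i=\mathbf T_i(X_i)$ are generated independently, $$\mathbb P_{(X_1,\dots,X_n)\sim p^{\otimes n}}(\phi(Y_1,\dots,Y_n)\ne p)+\mathbb P_{(X_1,\dots,X_n)\sim q^{\otimes n}}(\phi(Y_1,\dots,Y_n)\ne q)\le 0.1.$$ *)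

(* Defs.v *)
From mathcomp Require Import all_boot all_order all_algebra.
From mathcomp Require Import boolp classical_sets reals ereal esum sequences exp.

Set Implicit Arguments.
Unset Strict Implicit.
Unset Printing Implicit Defensive.

Import Order.TTheory GRing.Theory Num.Theory.
Local Open Scope classical_set_scope.
Local Open Scope ring_scope.

Definition is_pmf (R : realType) (X : finType) (p : X -> R) : Prop :=
  (forall x, 0 <= p x) /\ \sum_(x : X) p x = 1.

Definition dTV (R : realType) (X : finType) (p q : X -> R) : R :=
  2^-1 * \sum_(x : X) `|p x - q x|.

(* Squared Hellinger distance, without the factor 1/2. *)
Definition dh2 (R : realType) (X : finType) (p q : X -> R) : R :=
  \sum_(x : X) (Num.sqrt (p x) - Num.sqrt (q x)) ^+ 2.

(* The output comes first: T y x is the probability of y given x. *)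
Definition is_channel (R : realType) (X : finType) (Y : countType)
    (T : Y -> X -> R) : Prop :=
  (forall y x, 0 <= T y x) /\
  (forall x, (\esum_(y in [set: Y]) (T y x)%:E = 1)%E).

Definition is_LDP (R : realType) (X : finType) (Y : countType) (eps : R)
    (T : Y -> X -> R) : Prop :=
  forall x x' y, T y x <= expR eps * T y x'.

(* The probability that the vector of outputs Y_i = T_i(X_i) equals y, when
   X_1, ..., X_n are i.i.d. with law p and each Y_i is drawn independently
   given X_i. *)
Definition output_pmf (R : realType) (X : finType) (Y : countType) (n : nat)
    (T : 'I_n -> Y -> X -> R) (p : X -> R) (y : {ffun 'I_n -> Y}) : R :=
  \sum_(x : {ffun 'I_n -> X})
    (\prod_(i < n) p (x i)) * (\prod_(i < n) T i (y i) (x i)).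

Definition output_prob (R : realType) (X : finType) (Y : countType) (n : nat)
    (T : 'I_n -> Y -> X -> R) (p : X -> R) (A : set {ffun 'I_n -> Y})
    : \bar R :=
  (\esum_(y in A) (output_pmf T p y)%:E)%E.

Definition testable (R : realType) (X : finType) (p q : X -> R) (eps : R)
    (n : nat) : Prop :=
  exists (T : 'I_n -> nat -> X -> R) (phi : {ffun 'I_n -> nat} -> X -> R),
    [/\ forall i, is_channel (T i) /\ is_LDP eps (T i),
        forall y, phi y = p \/ phi y = q
      & (output_prob T p [set y | phi y <> p] +
         output_prob T q [set y | phi y <> q] <= (10^-1)%:E)%E].

(* Relational form of n = n^*(p, q, eps); at most one n satisfies it. *)
Definition is_sample_complexity (R : realType) (X : finType) (p q : X -> R)
    (eps : R) (n : nat) : Prop :=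
  testable p q eps n /\ (forall m, testable p q eps m -> (n <= m)%N).

Definition asymp (R : realType) (c1 c2 a b : R) : Prop :=
  c1 * b <= a /\ a <= c2 * b.

(* Main.v *)
(* The total error of the best test is the sum of the pointwise minima of the
   two output laws, which are product laws; the affinity (the sum of
   [sqrt (P * Q)]) tensorises and controls that sum from both sides.  Hence
   n^* is of the order of the inverse of the largest squared Hellinger distance
   that an eps-LDP channel can leave between its two outputs.

   Take p = (0, a, b) and q = (d, b, a - d) with a, b = (1 +- nu) / 2.  Then
   dTV = nu, and dh2 = rho is solved by a d between rho / 4 and rho.
   The points 1 and 2 carry the total variation (with a Hellinger contribution
   of order nu^2 only), the point 0 carries the Hellinger distance.  Randomized
   response on one of the events {1} and {0} achieves the claimed rates.
   Conversely, for an output symbol with likelihoods t0, t1, t2, one has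
   P - Q = nu (t1 - t2) - d (t0 - t2), and (sqrt P - sqrt Q)^2 is at most
   (P - Q)^2 / (P + Q); the LDP constraint bounds this by a linear form in
   t0, t1, t2, which sums over the symbols to the sum of its coefficients. *)
Require Import Defs.
From mathcomp Require Import all_boot all_order all_algebra finmap ring lra.
From mathcomp Require Import boolp classical_sets cardinality fsbigop.
From mathcomp Require Import reals ereal esum sequences exp.

Set Implicit Arguments.
Unset Strict Implicit.
Unset Printing Implicit Defensive.

Import Order.TTheory GRing.Theory Num.Theory.
Local Open Scope ring_scope.

(** * Sums over finite boxes and countable sums *)

(** The output law of a single user. The weights [p] are arbitrary reals, so that the same formula
    also gives the linear form with coefficients [g] in the lower bound. *)
Definition out_pmf (R : realType) (X : finType) (T : nat -> X -> R)
  (p : X -> R) (k : nat) : R := \sum_x p x * T k x.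

Lemma output_pmfE (R : realType) (X : finType) (n : nat)
    (T : 'I_n -> nat -> X -> R) (p : X -> R) (y : {ffun 'I_n -> nat}) :
  output_pmf T p y = \prod_(i < n) out_pmf (T i) p (y i).
Proof.
rewrite /output_pmf /out_pmf bigA_distr_bigA /=.
by apply: eq_bigr => x _; rewrite big_split.
Qed.

(** Embeds the finite box of side [N] into the countable output space, so that countable sums can be
    handled through finite ones. *)
Definition box_point (n N : nat) (z : {ffun 'I_n -> 'I_N}) : {ffun 'I_n -> nat} :=
  [ffun i => z i : nat].

Lemma box_point_inj (n N : nat) : injective (@box_point n N).
Proof.
move=> z1 z2 /ffunP e; apply/ffunP => i; apply: val_inj.
by have := e i; rewrite !ffunE.
Qed.

Lemma sum_box_fsbig (R : realType) (n N : nat) (f : {ffun 'I_n -> nat} -> R) :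
  (\sum_(y \in range (@box_point n N)) (f y)%:E)%E =
  (\sum_(z : {ffun 'I_n -> 'I_N}) f (box_point z))%:E.
Proof.
rewrite fsbig_image; last by move=> z1 z2 _ _; exact: box_point_inj.
rewrite fsbig_finite //= -sumEFin; apply: perm_big.
apply: uniq_perm; [exact: fset_uniq|exact: index_enum_uniq|].
by move=> z; rewrite [RHS]mem_index_enum in_fset_set ?mem_set //; exact: finite_finset.
Qed.

Lemma sum_box_le_esum (R : realType) (n N : nat) (f : {ffun 'I_n -> nat} -> R) :
  ((\sum_(z : {ffun 'I_n -> 'I_N}) f (box_point z))%:E <=
   \esum_(y in [set: {ffun 'I_n -> nat}]) (f y)%:E)%E.
Proof.
rewrite -sum_box_fsbig; apply: esum_ge; exists (range (@box_point n N)) => //.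
by split => //; exact: finite_image.
Qed.

(** A countable sum of nonnegative terms is the supremum of its finite subsums, and every finite set
    of outputs lies in some box. *)
Lemma esum_le_box (R : realType) (n : nat) (f : {ffun 'I_n -> nat} -> R) (c : R) :
  (forall y, 0 <= f y) ->
  (forall N, \sum_(z : {ffun 'I_n -> 'I_N}) f (box_point z) <= c) ->
  (\esum_(y in [set: {ffun 'I_n -> nat}]) (f y)%:E <= c%:E)%E.
Proof.
move=> f0 fc; apply: ge_ereal_sup => _ [F [finF _] <-].
pose N := (\max_(y <- fset_set F) \max_(i < n) y i).+1.
apply: (@le_trans _ _ (\sum_(y \in range (@box_point n N)) (f y)%:E)%E); last first.
  by rewrite sum_box_fsbig lee_fin.
apply: lee_fsum_nneg_subset => //; first exact: finite_image.
  move=> y; rewrite !inE => Fy.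
  have yN i : (y i < N)%N.
    rewrite ltnS (leq_trans (leq_bigmax i)) //.
    apply: (@leq_bigmax_seq _ _ _ (fun y : {ffun 'I_n -> nat} => \max_(i < n) y i)) => //.
    by rewrite in_fset_set // inE.
  exists [ffun i => Ordinal (yN i)] => //.
  by apply/ffunP => i; rewrite !ffunE.
by move=> y _; rewrite lee_fin.
Qed.

Lemma sum_box_prod (R : realType) (n N : nat) (F : 'I_n -> nat -> R) :
  \sum_(z : {ffun 'I_n -> 'I_N}) \prod_(i < n) F i (box_point z i) =
  \prod_(i < n) \sum_(k < N) F i k.
Proof.
rewrite bigA_distr_bigA /=; apply: eq_bigr => z _.
by apply: eq_bigr => i _; rewrite ffunE.
Qed.

Lemma channel_sum_le1 (R : realType) (X : finType) (T : nat -> X -> R) N x :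
  is_channel T -> \sum_(k < N) T k x <= 1.
Proof.
move=> [T0 T1]; rewrite -lee_fin -(T1 x) -sumEFin -nneseries_esumT; last first.
  by move=> k; rewrite lee_fin.
rewrite -(big_mkord xpredT (fun k => (T k x)%:E)).
by apply: nneseries_lim_ge => k _ _; rewrite lee_fin.
Qed.

Lemma channel_sum_ge (R : realType) (X : finType) (T : nat -> X -> R) x (k : R) :
  is_channel T -> 0 < k -> exists N0, forall N, (N0 <= N)%N ->
    1 - k <= \sum_(j < N) T j x.
Proof.
move=> [T0 T1] k0.
have : ((1 - k)%:E < \esum_(y in [set: nat]) (T y x)%:E)%E.
  by rewrite T1 lte_fin ltrBlDr ltrDl.
move=> /ereal_sup_gt[_ [F [finF _] <-]] /ltW lt1.
exists (\max_(k <- fset_set F) k).+1 => N leN.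
rewrite -lee_fin (le_trans lt1) // fsbig_finite //= -sumEFin.
rewrite -(big_mkord xpredT (fun k => (T k x)%:E)).
apply: (lee_sum_fset_nat (fset_set F) N xpredT) => [j _|j /= Fj].
  by rewrite lee_fin.
by apply: leq_trans leN; rewrite ltnS (@leq_bigmax_seq _ _ xpredT id).
Qed.

(** * Lower bound through the affinity *)

Lemma out_pmf_ge0 (R : realType) (X : finType) (T : nat -> X -> R) (p : X -> R) k :
  is_channel T -> is_pmf p -> 0 <= out_pmf T p k.
Proof. by move=> [T0 _] [p0 _]; apply: sumr_ge0 => x _; rewrite mulr_ge0. Qed.

Lemma output_pmf_ge0 (R : realType) (X : finType) n (T : 'I_n -> nat -> X -> R)
    (p : X -> R) y :
  (forall i, is_channel (T i)) -> is_pmf p -> 0 <= output_pmf T p y.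
Proof.
by move=> Tc pp; rewrite output_pmfE; apply: prodr_ge0 => i _; rewrite out_pmf_ge0.
Qed.

(** Since [p] and [q] differ, each outcome is an error under at least one of them, and so
    contributes at least the smaller of its two masses. *)
Lemma test_error_ge_min (R : realType) (X : finType) n (T : 'I_n -> nat -> X -> R)
    (p q : X -> R) (phi : {ffun 'I_n -> nat} -> X -> R) :
  (forall i, is_channel (T i)) -> is_pmf p -> is_pmf q -> p <> q ->
  (\esum_(y in [set: {ffun 'I_n -> nat}])
      (Num.min (output_pmf T p y) (output_pmf T q y))%:E <=
   output_prob T p [set y | phi y <> p] + output_prob T q [set y | phi y <> q])%E.
Proof.
move=> Tc pp pq pDq; rewrite /output_prob.
rewrite [X in (_ <= X + _)%E]esum_mkcond [X in (_ <= _ + X)%E]esum_mkcond.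
have P0 y : 0 <= output_pmf T p y by exact: output_pmf_ge0.
have Q0 y : 0 <= output_pmf T q y by exact: output_pmf_ge0.
rewrite -esumD; [|by move=> y _; case: ifP; rewrite ?lee_fin..].
apply: le_esum => y _.
have [py|py] := pselect (phi y = p).
  rewrite (@memNset _ [set y | phi y <> p]) /=; last by apply; exact: py.
  by rewrite mem_set /= ?py // add0e lee_fin ge_min lexx orbT.
rewrite (@mem_set _ [set y | phi y <> p]) //=.
by case: ifP => _; rewrite ?adde0 -?EFinD lee_fin ge_min ?lerDl ?Q0 ?lexx.
Qed.

(** The maximum likelihood test, with ties decided for [p], errs at each outcome with exactly the
    smaller mass. *)
Lemma testable_of_min (R : realType) (X : finType) n (T : 'I_n -> nat -> X -> R)
    (p q : X -> R) eps :
  (forall i, is_channel (T i) /\ is_LDP eps (T i)) -> is_pmf p -> is_pmf q ->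
  p <> q ->
  (forall N, \sum_(z : {ffun 'I_n -> 'I_N}) Num.min (output_pmf T p (box_point z))
     (output_pmf T q (box_point z)) <= 10^-1) ->
  testable p q eps n.
Proof.
move=> TT pp pq pDq err; have Tc i := (TT i).1.
have P0 y : 0 <= output_pmf T p y by exact: output_pmf_ge0.
have Q0 y : 0 <= output_pmf T q y by exact: output_pmf_ge0.
exists T, (fun y => if output_pmf T q y <= output_pmf T p y then p else q).
split => //; first by move=> y; case: ifP; [left|right].
have min0 y : 0 <= Num.min (output_pmf T p y) (output_pmf T q y).
  by rewrite le_min P0 Q0.
apply: (le_trans _ (esum_le_box min0 err)).
rewrite /output_prob.
rewrite [X in (X + _ <= _)%E]esum_mkcond [X in (_ + X <= _)%E]esum_mkcond.
rewrite -esumD; [|by move=> y _; case: ifP; rewrite ?lee_fin..].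
apply: le_esum => y _.
have [le|lt] := leP (output_pmf T q y) (output_pmf T p y).
  rewrite (@memNset _ [set y | _ <> p]) /= ?le; last by apply.
  by rewrite mem_set /= ?le // add0e.
have phiq : (if output_pmf T q y <= output_pmf T p y then p else q) = q.
  by rewrite leNgt lt.
rewrite (@memNset _ [set y | _ <> q]) /= ?phiq; last by apply.
by rewrite mem_set /= ?phiq ?adde0 // => e; exact: pDq.
Qed.

Lemma prod_ge_bernoulli (R : realDomainType) n (c : 'I_n -> R) (x : R) :
  0 <= x -> (forall i, 0 <= c i) -> (forall i, 1 - x <= c i) ->
  1 - n%:R * x <= \prod_(i < n) c i.
Proof.
move=> x0; elim: n c => [|n IH] c c0 c1; first by rewrite big_ord0 mul0r subr0.
rewrite big_ord_recl.
have := IH (fun i => c (lift ord0 i)) (fun i => c0 _) (fun i => c1 _).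
have := c1 ord0; have := c0 ord0.
have : 0 <= \prod_(i < n) c (lift ord0 i) by exact: prodr_ge0.
have n0 : 0 <= n%:R :> R by [].
rewrite -natr1; move: (c ord0) (\prod_(_ < _) _) (n%:R) n0 => a b m m0 b0 a0 a1 b1.
(* If [(m + 1) * x >= 1], the left side is nonpositive; otherwise [1 - x] and [1 - m * x] are both
   nonnegative and can be multiplied. *)
have [mx|mx] := leP 1 ((m + 1) * x).
  by apply: (@le_trans _ _ 0); [rewrite subr_le0|rewrite mulr_ge0].
have mx0 : 0 <= m * x by rewrite mulr_ge0.
have le : (1 - x) * (1 - m * x) <= a * b by apply: ler_pM => //; nra.
apply: le_trans le; nra.
Qed.

(** Twice the product of the roots is [P + Q] minus the squared difference of the roots, which is at
    most [(P - Q)^2 / (P + Q)], hence at most [G]. The hypothesis is free of division so that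
    [P = Q = 0] is covered. *)
Lemma sqrt_mul_ge (R : realType) (P Q G : R) :
  0 <= P -> 0 <= Q -> 0 <= G -> (P - Q) ^+ 2 <= (P + Q) * G ->
  2^-1 * (P + Q - G) <= Num.sqrt P * Num.sqrt Q.
Proof.
move=> P0 Q0 G0.
have := sqr_sqrtr P0; have := sqr_sqrtr Q0.
have := sqrtr_ge0 P; have := sqrtr_ge0 Q.
move: (Num.sqrt P) (Num.sqrt Q) => a b b0 a0 <- <- H.
have [ab|ab] := eqVneq (a + b) 0.
  have -> : a = 0 by lra.
  have -> : b = 0 by lra.
  lra.
have ab0 : 0 < a + b by lra.
suff : (a - b) ^+ 2 <= G by nra.
rewrite -(ler_pM2l (exprn_gt0 2 ab0)); apply: (@le_trans _ _ ((a ^+ 2 + b ^+ 2) * G)).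
  nra.
by rewrite ler_wpM2r //; nra.
Qed.

(** This is [8 a b <= 16 a^2 + b^2], with [a] the smaller of the two roots. With these weights an
    error of 1/10 forces the affinity down to [2/10 + 2/8 = 9/20], safely below 1. *)
Lemma sqrt_mul_le_min (R : realType) (P Q : R) :
  0 <= P -> 0 <= Q ->
  Num.sqrt P * Num.sqrt Q <= 2 * Num.min P Q + (P + Q) / 8.
Proof.
move=> P0 Q0; have [le|lt] := leP P Q.
  rewrite -{2 3}(sqr_sqrtr P0) -{2}(sqr_sqrtr Q0); move: (Num.sqrt P) (Num.sqrt Q) => a b.
  by have := sqr_ge0 (b - 4 * a); have := sqr_ge0 a; nra.
rewrite -{2}(sqr_sqrtr P0) -{2 3}(sqr_sqrtr Q0); move: (Num.sqrt P) (Num.sqrt Q) => a b.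
by have := sqr_ge0 (a - 4 * b); have := sqr_ge0 b; nra.
Qed.

Lemma sqrtr_prod (R : realType) n (F : 'I_n -> R) : (forall i, 0 <= F i) ->
  Num.sqrt (\prod_(i < n) F i) = \prod_(i < n) Num.sqrt (F i).
Proof.
move=> F0; elim: n F F0 => [|n IH] F F0; first by rewrite !big_ord0 sqrtr1.
by rewrite !big_ord_recl sqrtrM // IH.
Qed.

Lemma sum_out_pmf (R : realType) (X : finType) (T : nat -> X -> R) (p : X -> R) N :
  \sum_(k < N) out_pmf T p k = \sum_x p x * \sum_(k < N) T k x.
Proof.
by rewrite exchange_big /=; apply: eq_bigr => x _; rewrite mulr_sumr.
Qed.

Lemma sum_out_pmf_le1 (R : realType) (X : finType) (T : nat -> X -> R) (p : X -> R) N :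
  is_channel T -> is_pmf p -> \sum_(k < N) out_pmf T p k <= 1.
Proof.
move=> Tc [p0 p1]; rewrite sum_out_pmf -[leRHS]p1; apply: ler_sum => x _.
by rewrite ler_piMr // channel_sum_le1.
Qed.

Lemma sum_output_pmf_le1 (R : realType) (X : finType) n (T : 'I_n -> nat -> X -> R)
    (p : X -> R) N :
  (forall i, is_channel (T i)) -> is_pmf p ->
  \sum_(z : {ffun 'I_n -> 'I_N}) output_pmf T p (box_point z) <= 1.
Proof.
move=> Tc pp.
rewrite (eq_bigr _ (fun z _ => output_pmfE T p (box_point z))).
rewrite (sum_box_prod _ (fun i => out_pmf (T i) p)).
apply: prodr_ile1 => i _; rewrite sum_out_pmf_le1 // andbT.
by apply: sumr_ge0 => k _; exact: out_pmf_ge0.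
Qed.

(* [n] channels whose outputs each have squared Hellinger distance at most
   [\sum_x g x] leave an affinity of at least about [1 - n * \sum_x g x / 2],
   while a successful test forces the affinity below [9/20]. *)
Lemma testable_lower_bound (R : realType) (X : finType) (p q g : X -> R) eps n :
  is_pmf p -> is_pmf q -> p <> q -> (forall x, 0 <= g x) ->
  (forall t : X -> R, (forall x, 0 <= t x) ->
     (forall x x', t x <= expR eps * t x') ->
     (\sum_x p x * t x - \sum_x q x * t x) ^+ 2 <=
     (\sum_x p x * t x + \sum_x q x * t x) * \sum_x g x * t x) ->
  testable p q eps n -> 1 <= n%:R * \sum_x g x.
Proof.
move=> pp pq pDq g0 key [T [phi [TT _ err]]]; have Tc i := (TT i).1.
(* [kap] is the mass each user may lose by truncation: [n] users lose at most 1/20 in total, which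
   leaves [1 - 1/20 - 9/20 = 1/2] for the final comparison. The successor keeps the denominator
   positive for [n = 0]. *)
pose kap : R := (20 * n.+1%:R)^-1.
have kap0 : 0 < kap by rewrite invr_gt0 mulr_gt0.
have /choice[f fP] : forall ix : 'I_n * X, exists N0, forall N, (N0 <= N)%N ->
    1 - kap <= \sum_(j < N) T ix.1 j ix.2.
  by move=> ix; exact: channel_sum_ge.
(* One truncation level that serves all users and all inputs. *)
pose N := \max_ix f ix.
have TN i x : 1 - kap <= \sum_(j < N) T i j x.
  exact: (fP (i, x) N (leq_bigmax (i, x))).
have mass r i : is_pmf r -> 1 - kap <= \sum_(k < N) out_pmf (T i) r k.
  move=> [r0 r1]; rewrite sum_out_pmf -[leLHS]mul1r -{1}r1 mulr_suml.
  by apply: ler_sum => x _; rewrite ler_wpM2l.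
pose P i k := out_pmf (T i) p k; pose Q i k := out_pmf (T i) q k.
have P0 i k : 0 <= P i k by exact: out_pmf_ge0.
have Q0 i k : 0 <= Q i k by exact: out_pmf_ge0.
have G0 : 0 <= \sum_x g x by exact: sumr_ge0.
pose c i := \sum_(k < N) Num.sqrt (P i k) * Num.sqrt (Q i k).
have c0 i : 0 <= c i by apply: sumr_ge0 => k _; rewrite mulr_ge0.
have cG i : 1 - (kap + 2^-1 * \sum_x g x) <= c i.
  have : \sum_(k < N) 2^-1 * (P i k + Q i k - out_pmf (T i) g k) <= c i.
    apply: ler_sum => k _; have [T0 _] := Tc i; apply: sqrt_mul_ge => //.
      by apply: sumr_ge0 => x _; rewrite mulr_ge0.
    by apply: key => // x x'; exact: (TT i).2.
  rewrite -mulr_sumr sumrB big_split /= (sum_out_pmf _ g).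
  have : \sum_x g x * \sum_(k < N) T i k x <= \sum_x g x.
    by apply: ler_sum => x _; rewrite ler_piMr // channel_sum_le1.
  have : 1 - kap <= \sum_(k < N) P i k by exact: mass.
  have : 1 - kap <= \sum_(k < N) Q i k by exact: mass.
  lra.
(* The affinity tensorises: over a box, the affinity of the product laws is the product of the
   users' affinities. *)
have aff : \prod_(i < n) c i =
    \sum_(z : {ffun 'I_n -> 'I_N}) Num.sqrt (output_pmf T p (box_point z)) *
      Num.sqrt (output_pmf T q (box_point z)).
  rewrite -(sum_box_prod _ (fun i k => Num.sqrt (P i k) * Num.sqrt (Q i k))).
  apply: eq_bigr => z _; rewrite !output_pmfE big_split /=.
  by rewrite !sqrtr_prod // => i; [exact: Q0|exact: P0].
have errN : \sum_(z : {ffun 'I_n -> 'I_N}) Num.min (output_pmf T p (box_point z))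
     (output_pmf T q (box_point z)) <= 10^-1.
  rewrite -lee_fin; apply: le_trans err.
  by apply: le_trans (test_error_ge_min _ Tc pp pq pDq); exact: sum_box_le_esum.
have affle : \prod_(i < n) c i <= 2 * 10^-1 + (1 + 1) / 8.
  rewrite aff; apply: (@le_trans _ _ (\sum_(z : {ffun 'I_n -> 'I_N})
     (2 * Num.min (output_pmf T p (box_point z)) (output_pmf T q (box_point z)) +
     (output_pmf T p (box_point z) + output_pmf T q (box_point z)) / 8))).
    by apply: ler_sum => z _; apply: sqrt_mul_le_min; exact: output_pmf_ge0.
  rewrite big_split /= -mulr_sumr -mulr_suml big_split /=.
  have := @sum_output_pmf_le1 _ _ _ _ _ N Tc pp.
  have := @sum_output_pmf_le1 _ _ _ _ _ N Tc pq.
  by move: errN; lra.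
have x0 : 0 <= kap + 2^-1 * \sum_x g x by rewrite addr_ge0 ?mulr_ge0 // ltW.
have := prod_ge_bernoulli x0 c0 cG.
have : n%:R * kap <= 20^-1.
  rewrite /kap invfM mulrCA ler_piMr // ler_pdivrMr ?ltr0Sn // mul1r ler_nat.
  exact: leqnSn.
move: affle; lra.
Qed.

(** * Binary channels and randomized response *)

(** A two-symbol channel coded with outputs in [nat], as [testable] demands; symbols from 2 on have
    mass zero. *)
Definition binary_channel (R : realType) (X : finType) (r : X -> R)
    (k : nat) (x : X) : R :=
  if k == 0%N then 1 - r x else if k == 1%N then r x else 0.

Lemma binary_channelP (R : realType) (X : finType) (r : X -> R) :
  (forall x, 0 <= r x <= 1) -> is_channel (binary_channel r).
Proof.
move=> r01; have T0 k x : 0 <= binary_channel r k x.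
  by rewrite /binary_channel; have := r01 x; case: ifP => _; [|case: ifP => _]; lra.
split=> // x.
transitivity (\esum_(y in `I_2) (binary_channel r y x)%:E)%E.
  rewrite [RHS]esum_mkcond; apply: eq_esum => k _; case: ifPn => //.
  by rewrite notin_setE /= /binary_channel; case: k => [|[|k]].
rewrite esum_fset; [|exact: finite_II|by move=> k _; rewrite lee_fin].
rewrite -fsbig_ord !big_ord_recl big_ord0 /binary_channel /= adde0 -EFinD.
by congr (_%:E); lra.
Qed.

(** [(1 - x)^n <= exp (- n x) <= exp (- 9)], and [exp 9 >= 1 + 9]. *)
Lemma expr_1sub_le_tenth (R : realType) (x : R) n :
  0 <= x -> x <= 1 -> 9 <= n%:R * x -> (1 - x) ^+ n <= 10^-1.
Proof.
move=> x0 x1 nx.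
apply: (@le_trans _ _ (expR (- x) ^+ n)).
  by apply: lerXn2r; rewrite ?nnegrE ?subr_ge0 ?expR_ge0 // expR_ge1Dx.
rewrite -expRM_natr mulrC mulrN expRN lef_pV2 ?posrE ?expR_gt0 ?ltr0n //.
by apply: le_trans (expR_ge1Dx _); lra.
Qed.

Lemma sqr_sub_le_sqrt (R : realType) (u v : R) : 0 <= u -> 0 <= v ->
  (u - v) ^+ 2 <= 2 * (u + v) * (Num.sqrt u - Num.sqrt v) ^+ 2.
Proof.
move=> u0 v0; have := sqr_sqrtr u0; have := sqr_sqrtr v0.
move: (Num.sqrt u) (Num.sqrt v) => a b <- <-.
by rewrite subr_sqr exprMn mulrC ler_wpM2r ?sqr_ge0 //; have := sqr_ge0 (a - b); nra.
Qed.

(** The affinity of the two binary outputs is at most [1 - x], where [x] is half the squared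
    difference of the roots of [u] and [v], and [x >= (u - v)^2 / (4 (u + v))]. The constant
    [36 = 4 * 9] makes [n x >= 9], which brings the [n]-th power below 1/10. *)
Lemma testable_binary (R : realType) (X : finType) (p q r : X -> R) eps n (u v : R) :
  is_pmf p -> is_pmf q -> p <> q -> (forall x, 0 <= r x <= 1) ->
  (forall x x', r x <= expR eps * r x') ->
  (forall x x', 1 - r x <= expR eps * (1 - r x')) ->
  u = \sum_x p x * r x -> v = \sum_x q x * r x -> 0 < u + v ->
  36 * (u + v) <= n%:R * (u - v) ^+ 2 ->
  testable p q eps n.
Proof.
move=> pp pq pDq r01 r1 r2 uE vE uv0 hn.
have Tc := binary_channelP r01.
have P0 rr : is_pmf rr -> out_pmf (binary_channel r) rr 0 = 1 - \sum_x rr x * r x.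
  move=> [_ <-]; rewrite /out_pmf -sumrB; apply: eq_bigr => x _.
  by rewrite mulrBr mulr1.
have P1 rr : out_pmf (binary_channel r) rr 1 = \sum_x rr x * r x by [].
have P2 rr k : out_pmf (binary_channel r) rr k.+2 = 0.
  by rewrite /out_pmf big1 // => x _; rewrite mulr0.
have mean01 rr : is_pmf rr -> 0 <= \sum_x rr x * r x <= 1.
  move=> prr; apply/andP; split; first by rewrite -P1; exact: out_pmf_ge0.
  by rewrite -subr_ge0 -P0 //; exact: out_pmf_ge0.
have /andP[u0 u1] : 0 <= u <= 1 by rewrite uE mean01.
have /andP[v0 v1] : 0 <= v <= 1 by rewrite vE mean01.
pose x := 2^-1 * (Num.sqrt u - Num.sqrt v) ^+ 2.
have su := sqr_sqrtr u0; have sv := sqr_sqrtr v0.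
have su0 := sqrtr_ge0 u; have sv0 := sqrtr_ge0 v.
have su1 : Num.sqrt u <= 1 by rewrite -sqrtr1 ler_wsqrtr.
have sv1 : Num.sqrt v <= 1 by rewrite -sqrtr1 ler_wsqrtr.
have x0 : 0 <= x by rewrite mulr_ge0 ?sqr_ge0.
have x1 : x <= 1 by rewrite /x; move: su0 sv0 su1 sv1; clear; nra.
have xn : 9 <= n%:R * x.
  have n0 : 0 <= n%:R :> R by [].
  rewrite -(ler_pM2r uv0); apply: (@le_trans _ _ (4^-1 * (n%:R * (u - v) ^+ 2))).
    by move: hn; lra.
  rewrite mulrCA -[leRHS]mulrA ler_wpM2l //.
  by have := sqr_sub_le_sqrt u0 v0; rewrite /x; lra.
have c2 N : 0 <= \sum_(k < N) Num.sqrt (out_pmf (binary_channel r) p k) *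
    Num.sqrt (out_pmf (binary_channel r) q k) <= 1 - x.
  apply/andP; split; first by apply: sumr_ge0 => k _; rewrite mulr_ge0.
  have c01 : Num.sqrt (1 - u) * Num.sqrt (1 - v) + Num.sqrt u * Num.sqrt v <= 1 - x.
    have u1' : 0 <= 1 - u by rewrite subr_ge0.
    have v1' : 0 <= 1 - v by rewrite subr_ge0.
    have := sqr_sqrtr u1'; have := sqr_sqrtr v1'.
    have := sqr_ge0 (Num.sqrt (1 - u) - Num.sqrt (1 - v)).
    by rewrite /x; move: su sv; clear; nra.
  (* Boxes of side 0 or 1 miss some of the two symbols and only make the sum smaller. *)
  apply: le_trans c01; case: N => [|[|N]].
  - by rewrite big_ord0 addr_ge0 ?mulr_ge0.
  - by rewrite big_ord_recl big_ord0 addr0 /= !P0 // -uE -vE lerDl mulr_ge0.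
  - rewrite !big_ord_recl big1 /=; last by move=> k _; rewrite P2 sqrtr0 mul0r.
    by rewrite !P0 // !P1 -uE -vE addr0.
apply: (@testable_of_min _ _ _ (fun=> binary_channel r)) => //.
  move=> _; split=> // y y' k; rewrite /binary_channel.
  by case: ifP => _; [exact: r2|case: ifP => _; rewrite ?mulr0].
move=> N; apply: le_trans (expr_1sub_le_tenth x0 x1 xn).
have O0 := output_pmf_ge0 _ (fun=> Tc).
(* The smaller of two masses is at most their geometric mean, whose sum over the box factorises over
   the users. *)
apply: (@le_trans _ _ (\sum_(z : {ffun 'I_n -> 'I_N})
    \prod_(i < n) (Num.sqrt (out_pmf (binary_channel r) p (box_point z i)) *
    Num.sqrt (out_pmf (binary_channel r) q (box_point z i))))).
  apply: ler_sum => z _; rewrite big_split /= -!sqrtr_prod; last first.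
  - by move=> i; exact: out_pmf_ge0.
  - by move=> i; exact: out_pmf_ge0.
  rewrite -!(output_pmfE (fun=> binary_channel r)).
  have := O0 n p (box_point z) pp; have := O0 n q (box_point z) pq.
  move: (output_pmf _ _ _) (output_pmf _ _ _) => a b a0 b0.
  rewrite -sqrtrM // -[leLHS]ger0_norm ?le_min ?a0 ?b0 // -sqrtr_sqr ler_wsqrtr //.
  by case: (leP b a) => ab; rewrite expr2 ?ler_wpM2l ?ler_wpM2r // ltW.
rewrite (sum_box_prod _ (fun _ k => Num.sqrt (out_pmf (binary_channel r) p k) *
    Num.sqrt (out_pmf (binary_channel r) q k))).
rewrite -[n in leRHS]card_ord -prodr_const.
by apply: ler_prod => i _; exact: c2.
Qed.

(** Each user reports membership in [A] truthfully with odds [exp eps] to 1. The condition is that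
    of the binary test with [u], [v] the two probabilities of reporting 1, multiplied by
    [(1 + exp eps)^2]. *)
Lemma testable_randomized_response (R : realType) (X : finType) (p q : X -> R)
    (A : pred X) eps n (PA QA : R) :
  is_pmf p -> is_pmf q -> p <> q -> 0 < eps ->
  PA = \sum_(x | A x) p x -> QA = \sum_(x | A x) q x ->
  36 * (2 + (expR eps - 1) * (PA + QA)) * (1 + expR eps) <=
    n%:R * ((expR eps - 1) * (PA - QA)) ^+ 2 ->
  testable p q eps n.
Proof.
move=> pp pq pDq eps0 PAE QAE.
have e1 : 1 < expR eps by rewrite expR_gt1.
set e := expR eps in e1 *; move=> hn.
pose r x : R := (if A x then e else 1) / (1 + e).
have e10 : 0 < 1 + e by lra.
have e1n : 1 + e != 0 by rewrite gt_eqF.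
have mean f : is_pmf f -> \sum_x f x * r x = (1 + (e - 1) * \sum_(x | A x) f x) / (1 + e).
  move=> [_ f1]; rewrite -[X in X + _]f1 mulr_sumr [X in _ + X]big_mkcond -big_split mulr_suml.
  by apply: eq_bigr => x _; rewrite /r /=; case: ifP => _; field.
have cr x : 1 - r x = (if A x then 1 else e) / (1 + e).
  by rewrite /r; case: ifP => _; field.
have ratio (x y : R) : 0 < x -> 0 < y -> x <= e -> 1 <= y ->
    x / (1 + e) <= e * (y / (1 + e)).
  by move=> x0 y0 xe y1; rewrite mulrA ler_pM2r ?invr_gt0 //; nra.
have PA0 : 0 <= PA by rewrite PAE sumr_ge0 // => x _; exact: pp.1.
have QA0 : 0 <= QA by rewrite QAE sumr_ge0 // => x _; exact: pq.1.
have ePQ : 0 <= (e - 1) * (PA + QA) by rewrite mulr_ge0 //; lra.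
apply: (@testable_binary _ _ p q r eps n ((1 + (e - 1) * PA) / (1 + e))
  ((1 + (e - 1) * QA) / (1 + e))) => //.
- move=> x; have r0 : 0 <= r x by rewrite /r; case: ifP => _; apply: divr_ge0; lra.
  have r1 : 0 <= 1 - r x by rewrite cr; case: ifP => _; apply: divr_ge0; lra.
  by rewrite r0 -subr_ge0.
- by move=> x x'; rewrite /r; apply: ratio; case: ifP => _; lra.
- by move=> x x'; rewrite !cr; apply: ratio; case: ifP => _; lra.
- by rewrite mean // PAE.
- by rewrite mean // QAE.
- by rewrite -mulrDl divr_gt0 //; lra.
have -> : (1 + (e - 1) * PA) / (1 + e) - (1 + (e - 1) * QA) / (1 + e) =
  (e - 1) * (PA - QA) / (1 + e) by field.
rewrite expr_div_n mulrA ler_pdivlMr ?exprn_gt0 //.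
suff -> : 36 * ((1 + (e - 1) * PA) / (1 + e) + (1 + (e - 1) * QA) / (1 + e)) *
  (1 + e) ^+ 2 = 36 * (2 + (e - 1) * (PA + QA)) * (1 + e) by [].
by field.
Qed.

(** * The ternary pair *)

Definition ternary (R : realType) (a b c : R) (x : 'I_3) : R := [:: a; b; c]`_x.

Lemma sum_ord3 (R : realType) (F : 'I_3 -> R) :
  \sum_x F x = F (inord 0) + F (inord 1) + F (inord 2).
Proof.
rewrite !big_ord_recl big_ord0 addr0 addrA.
by congr (F _ + F _ + F _); apply: val_inj; rewrite /= inordK.
Qed.

Lemma sum_ternary (R : realType) (a b c : R) (F : R -> 'I_3 -> R) :
  \sum_x F (ternary a b c x) x = F a (inord 0) + F b (inord 1) + F c (inord 2).
Proof. by rewrite sum_ord3 /ternary !inordK. Qed.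

Lemma ternary_pmf (R : realType) (x y z : R) : 0 <= x -> 0 <= y -> 0 <= z -> x + y + z = 1 ->
  is_pmf (ternary x y z).
Proof.
move=> x0 y0 z0 xyz; split; last by rewrite (sum_ternary _ _ _ (fun r _ => r)).
by case=> [[|[|[|k]]] lk].
Qed.

(** In the unknown [s], the root of [(1 + nu) / 2 - d], the squares of [s] cancel and the equation
    becomes linear, so [d] has a closed form. *)
Lemma hellinger_solution (R : realType) (rho nu : R) :
  0 < rho -> rho < 2^-1 -> 0 < nu -> nu < 2^-1 -> 2 * nu ^+ 2 <= rho -> rho <= nu ->
  exists d : R, [/\ rho / 4 <= d, d <= rho &
    d + (Num.sqrt ((1 + nu) / 2) - Num.sqrt ((1 - nu) / 2)) ^+ 2 +
      (Num.sqrt ((1 - nu) / 2) - Num.sqrt ((1 + nu) / 2 - d)) ^+ 2 = rho].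
Proof.
move=> rho0 rho1 nu0 nu1 h1 h2.
have a0 : 0 < (1 + nu) / 2 by lra.
have b0 : 0 < (1 - nu) / 2 by lra.
set sa := Num.sqrt ((1 + nu) / 2); set sb := Num.sqrt ((1 - nu) / 2).
have sa2 : sa ^+ 2 = (1 + nu) / 2 by rewrite sqr_sqrtr // ltW.
have sb2 : sb ^+ 2 = (1 - nu) / 2 by rewrite sqr_sqrtr // ltW.
have sa0 : 0 < sa by rewrite sqrtr_gt0.
have sb0 : 0 < sb by rewrite sqrtr_gt0.
pose w := sa * sb; pose s := (1 - rho / 2 - w) / sb.
have w0 : 0 < w by rewrite mulr_gt0.
have w2 : 4 * w ^+ 2 = 1 - nu ^+ 2 by rewrite exprMn sa2 sb2; field.
have w1 : w <= 2^-1.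
  rewrite -(@ler_pXn2r _ 2) ?nnegrE //; [|exact: ltW].
  by have := sqr_ge0 nu; lra.
(* [2 w] is the root of [1 - nu^2]. A coefficient slightly above 1/2 suffices as [nu^2 <= 1/4], and
   [2 nu^2 <= rho] then gives [2 w - 1 + rho / 2 >= 0.225 rho], hence the lower bound on [d]. *)
have w3 : 1 - 55 / 100 * nu ^+ 2 <= 2 * w.
  have n2 : nu ^+ 2 <= 4^-1 by nra.
  rewrite -(@ler_pXn2r _ 2) ?nnegrE //; [|lra|lra].
  rewrite exprMn; have := sqr_ge0 nu; move: (nu ^+ 2) n2 w2 => t t1 t2 t3; nra.
have s0 : 0 <= s by rewrite divr_ge0 ?(ltW sb0) //; lra.
have sbs : sb * s = 1 - rho / 2 - w by rewrite /s; field; rewrite gt_eqF.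
pose d := (1 + nu) / 2 - s ^+ 2.
have eq : d + (sa - sb) ^+ 2 + (sb - s) ^+ 2 = rho.
  have -> : d + (sa - sb) ^+ 2 + (sb - s) ^+ 2 =
    (1 + nu) / 2 + sa ^+ 2 + 2 * sb ^+ 2 - 2 * w - 2 * (sb * s) by rewrite /d /w; ring.
  by rewrite sbs sa2 sb2; field.
exists d; split.
- have bd : (1 - nu) / 2 * d = (2 * w - 1 + rho / 2) * (1 - rho / 2).
    have -> : (1 - nu) / 2 * d = w ^+ 2 - (sb * s) ^+ 2.
      by rewrite /d -sa2 -sb2 /w; ring.
    by rewrite sbs; ring.
  rewrite -(ler_pM2l b0) bd.
  apply: (@le_trans _ _ (225 / 1000 * rho * (3 / 4))); first by nra.
  by apply: ler_pM; lra.
- by rewrite -[leRHS]eq -addrA lerDl addr_ge0 ?sqr_ge0.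
- have -> : (1 + nu) / 2 - d = s ^+ 2 by rewrite /d; ring.
  by rewrite sqrtr_sqr ger0_norm.
Qed.

(** From [1 + y <= exp y] at [y = - x / 2] one gets [exp (x / 2) <= 2]; at [y = - x] one gets
    [exp x - 1 <= x exp x]. *)
Lemma expR_sub1_le (R : realType) (x : R) : 0 < x -> x <= 1 ->
  expR x - 1 <= 4 * x /\ expR x <= 4.
Proof.
move=> x0 x1.
have e4 : expR x <= 4.
  have h : 2^-1 <= expR (- (x / 2)) by apply: le_trans (expR_ge1Dx _); lra.
  have u2 : expR (x / 2) <= 2.
    have : expR (x / 2) * 2^-1 <= expR (x / 2) * expR (- (x / 2)).
      by rewrite ler_wpM2l ?expR_ge0.
    by rewrite expRxMexpNx_1; lra.
  have -> : x = x / 2 + x / 2 by field.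
  rewrite expRD; have -> : 4 = 2 * 2 :> R by ring.
  by rewrite ler_pM ?expR_ge0.
split=> //.
have : expR x * (1 - x) <= expR x * expR (- x).
  by rewrite ler_wpM2l ?expR_ge0 // expR_ge1Dx.
have : expR x * x <= 4 * x by rewrite ler_wpM2r // ltW.
by rewrite expRxMexpNx_1; lra.
Qed.

(** The numerical constraints in a form suited to linear arithmetic: [a], [b] are known by their sum
    and difference, [d] by its order of magnitude. The Hellinger equation stays apart and serves
    only to compute [dh2]. *)
Record pair_params (R : realType) (rho nu d a b : R) : Prop := PairParams {
  _ : 0 < rho; _ : rho < 2^-1; _ : 0 < nu; _ : nu < 2^-1;
  _ : 2 * nu ^+ 2 <= rho; _ : rho <= nu; _ : rho / 4 <= d; _ : d <= rho;
  _ : a + b = 1; _ : a - b = nu }.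

Section ternary_pair.
Variables (R : realType) (rho nu d a b : R).
Hypothesis params : pair_params rho nu d a b.

Let p := ternary 0 a b.
Let q := ternary d b (a - d).

Lemma left_pmf : is_pmf p.
Proof.
by case: params => *; apply: ternary_pmf; lra.
Qed.
Lemma right_pmf : is_pmf q.
Proof.
by case: params => *; apply: ternary_pmf; lra.
Qed.

Lemma dTV_ternary_pair : dTV p q = nu.
Proof.
case: params => rho0 rho1 nu0 nu1 nurho rhonu d0 d1 ab1 abnu.
rewrite /dTV sum_ord3 /p /q /ternary !inordK //= sub0r normrN.
rewrite (@ger0_norm _ d); last lra.
rewrite ger0_norm; last by lra.
rewrite ler0_norm; last by lra.
lra.
Qed.

Lemma left_neq_right : p <> q.
Proof.
case: params => rho0 rho1 nu0 nu1 nurho rhonu d0 d1 ab1 abnu.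
by move=> /(congr1 (fun f => f (inord 0))); rewrite /p /q /ternary inordK //=; lra.
Qed.

Lemma dh2_ternary_pair : d + (Num.sqrt a - Num.sqrt b) ^+ 2 + (Num.sqrt b - Num.sqrt (a - d)) ^+ 2
    = rho -> dh2 p q = rho.
Proof.
case: params => rho0 rho1 nu0 nu1 nurho rhonu d0 d1 ab1 abnu.
move=> <-; rewrite /dh2 sum_ord3 /p /q /ternary !inordK //= sqrtr0 sub0r sqrrN.
by rewrite sqr_sqrtr //; lra.
Qed.

(** * Lower bounds for the ternary pair in the three privacy regimes *)

(** The affinity bound written out in coordinates. [P] and [Q] are variables tied by equations, so
    that arithmetic can treat them as atoms. *)
Lemma ternary_lower_bound (eps g0 g1 g2 : R) n :
  0 <= g0 -> 0 <= g1 -> 0 <= g2 ->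
  (forall t0 t1 t2 : R, 0 <= t0 -> 0 <= t1 -> 0 <= t2 ->
     t0 <= expR eps * t1 -> t0 <= expR eps * t2 -> t1 <= expR eps * t0 ->
     t1 <= expR eps * t2 -> t2 <= expR eps * t0 -> t2 <= expR eps * t1 ->
     forall P Q : R, P = a * t1 + b * t2 -> Q = d * t0 + b * t1 + (a - d) * t2 ->
     (P - Q) ^+ 2 <= (P + Q) * (g0 * t0 + g1 * t1 + g2 * t2)) ->
  testable p q eps n -> 1 <= n%:R * (g0 + g1 + g2).
Proof.
move=> g00 g10 g20 key.
have -> : g0 + g1 + g2 = \sum_x ternary g0 g1 g2 x.
  by rewrite (sum_ternary _ _ _ (fun r _ => r)).
apply: testable_lower_bound; [exact: left_pmf|exact: right_pmf|exact: left_neq_right| |].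
  by case=> [[|[|[|k]]] lk].
move=> t t0 tt; rewrite !(sum_ternary _ _ _ (fun r x => r * t x)).
by apply: key => //; rewrite mul0r add0r.
Qed.

(** Since [nu < 1/2], both [a] and [b] are at least 1/4; the term in [t0] comes from [Q]. *)
Lemma output_sum_ge (P Q t0 t1 t2 : R) : P = a * t1 + b * t2 ->
  Q = d * t0 + b * t1 + (a - d) * t2 -> 0 <= t0 -> 0 <= t1 -> 0 <= t2 ->
  4^-1 * (t1 + t2) + d * t0 <= P + Q.
Proof.
case: params => rho0 rho1 nu0 nu1 nurho rhonu d0 d1 ab1 abnu.
move=> -> -> t00 t10 t20.
have : 4^-1 * t1 <= a * t1 by rewrite ler_wpM2r //; lra.
have : 4^-1 * t2 <= b * t2 by rewrite ler_wpM2r //; lra.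
have : 0 <= b * t1 by rewrite mulr_ge0 //; lra.
have : 0 <= (a - d) * t2 by rewrite mulr_ge0 //; lra.
lra.
Qed.

Lemma output_diff_eq (P Q t0 t1 t2 : R) : P = a * t1 + b * t2 ->
  Q = d * t0 + b * t1 + (a - d) * t2 -> P - Q = nu * (t1 - t2) - d * (t0 - t2).
Proof.
case: params => rho0 rho1 nu0 nu1 nurho rhonu d0 d1 ab1 abnu.
by move=> -> ->; rewrite -abnu; ring.
Qed.

Lemma output_diff_sqr_le (P Q t0 t1 t2 : R) : P = a * t1 + b * t2 ->
  Q = d * t0 + b * t1 + (a - d) * t2 -> 0 <= t0 -> 0 <= t1 -> 0 <= t2 ->
  (P - Q) ^+ 2 <= 2 * nu ^+ 2 * (t1 + t2) ^+ 2 + 2 * d ^+ 2 * (t0 ^+ 2 + t2 ^+ 2).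
Proof.
case: params => rho0 rho1 nu0 nu1 nurho rhonu d0 d1 ab1 abnu.
move=> PE QE t00 t10 t20; rewrite (output_diff_eq PE QE).
have : 0 <= nu ^+ 2 * (t1 * t2) by rewrite mulr_ge0 ?sqr_ge0 // mulr_ge0.
have : 0 <= d ^+ 2 * (t0 * t2) by rewrite mulr_ge0 ?sqr_ge0 // mulr_ge0.
have := sqr_ge0 (nu * (t1 - t2) + d * (t0 - t2)).
lra.
Qed.

(** For [eps <= 1] the likelihoods differ by a relative amount of order [eps]. As [d <= nu], the
    difference of [P] and [Q] is of order [eps nu (t1 + t2)], and [t1 + t2 <= 4 (P + Q)]. *)
Lemma lower_high_privacy (eps : R) n : 0 < eps -> eps <= 1 -> testable p q eps n ->
  1 <= n%:R * (40 * 80 * (eps ^+ 2 * nu ^+ 2)).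
Proof.
case: params => rho0 rho1 nu0 nu1 nurho rhonu d0 d1 ab1 abnu.
(* [c] is the coefficient of both [t1] and [t2], while [t0] gets 0. It is [20^2 * 4] times
   [eps^2 nu^2]: 20 from the bound [D], 4 from [output_sum_ge]. *)
move=> eps0 eps1; have [c cE] : exists c, c = 20 * 80 * (eps ^+ 2 * nu ^+ 2) by eexists.
have -> : 40 * 80 * (eps ^+ 2 * nu ^+ 2) = 0 + c + c by rewrite cE; ring.
have c0 : 0 <= c by rewrite cE; apply: mulr_ge0; [lra|rewrite mulr_ge0 ?sqr_ge0].
have [eps4 e4] := expR_sub1_le eps0 eps1.
apply: ternary_lower_bound => // t0 t1 t2 t00 t10 t20 t01 t02 t10' t12 t20' t21 P Q PE QE.
have S0 : 0 <= t1 + t2 by lra.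
have SPQ := output_sum_ge PE QE t00 t10 t20.
have dt0 : 0 <= d * t0 by rewrite mulr_ge0 //; lra.
have lip (x y : R) : 0 <= x -> 0 <= y -> x <= expR eps * y -> x - y <= 4 * eps * y.
  move=> x0 y0 xy; have : (expR eps - 1) * y <= 4 * eps * y by rewrite ler_wpM2r //; lra.
  lra.
have t04 : t0 <= 4 * t2 by apply: le_trans t02 _; rewrite ler_wpM2r.
have et1 : 0 <= eps * t1 by rewrite mulr_ge0 // ltW.
have et2 : 0 <= eps * t2 by rewrite mulr_ge0 // ltW.
have et0 : eps * t0 <= 4 * (eps * t2) by rewrite mulrCA ler_wpM2l // ltW.
have D1 : `|t1 - t2| <= 4 * eps * (t1 + t2).
  by have := lip _ _ t10 t20 t12; have := lip _ _ t20 t10 t21; rewrite ler_norml; lra.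
have D2 : `|t0 - t2| <= 16 * eps * (t1 + t2).
  by have := lip _ _ t00 t20 t02; have := lip _ _ t20 t00 t20'; rewrite ler_norml; lra.
have D : `|P - Q| <= 20 * (eps * nu) * (t1 + t2).
  rewrite (output_diff_eq PE QE).
  apply: le_trans (ler_normB _ _) _; rewrite !normrM.
  rewrite (ger0_norm (ltW nu0)) (@ger0_norm _ d); last lra.
  have : nu * `|t1 - t2| <= nu * (4 * eps * (t1 + t2)) by rewrite ler_wpM2l // ltW.
  have : d * `|t0 - t2| <= nu * (16 * eps * (t1 + t2)) by apply: ler_pM => //; lra.
  lra.
rewrite -real_normK ?num_real //.
apply: (@le_trans _ _ ((20 * (eps * nu) * (t1 + t2)) ^+ 2)).
  by rewrite lerXn2r // nnegrE // !mulr_ge0 // ltW.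
have : (t1 + t2) * (c * (t1 + t2)) <= 4 * (P + Q) * (c * (t1 + t2)).
  by apply: ler_wpM2r; [exact: mulr_ge0|lra].
by rewrite cE; lra.
Qed.

(** One factor of each square is bounded by [P + Q]: [t1] and [t2] directly, [t0] through
    [t0 <= exp eps * t1], which produces the term [exp eps * rho^2]. *)
Lemma lower_moderate_privacy (eps : R) n : 1 <= expR eps -> testable p q eps n ->
  1 <= n%:R * (16 * (nu ^+ 2 + expR eps * rho ^+ 2)).
Proof.
case: params => rho0 rho1 nu0 nu1 nurho rhonu d0 d1 ab1 abnu.
move=> e1 tst.
suff : 1 <= n%:R * (8 * d ^+ 2 * expR eps + 8 * nu ^+ 2 + (8 * nu ^+ 2 + 8 * d ^+ 2)).
  move=> /le_trans; apply; rewrite ler_wpM2l //.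
  have d2 : d ^+ 2 <= rho ^+ 2 by rewrite lerXn2r ?nnegrE; lra.
  have : expR eps * d ^+ 2 <= expR eps * rho ^+ 2 by rewrite ler_wpM2l //; lra.
  have : 1 * rho ^+ 2 <= expR eps * rho ^+ 2 by rewrite ler_wpM2r // sqr_ge0.
  lra.
have nn := sqr_ge0 nu; have dd := sqr_ge0 d.
apply: ternary_lower_bound tst; [by apply: mulr_ge0; [lra|exact: expR_ge0]|lra|lra|].
move=> t0 t1 t2 t00 t10 t20 t01 t02 t10' t12 t20' t21 P Q PE QE.
have PQ := output_sum_ge PE QE t00 t10 t20.
have dt0 : 0 <= d * t0 by rewrite mulr_ge0 //; lra.
have PQ0 : 0 <= P + Q by lra.
have diff : (P - Q) ^+ 2 <= 2 * nu ^+ 2 * (t1 + t2) ^+ 2 + 2 * d ^+ 2 * (t0 ^+ 2 + t2 ^+ 2).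
  exact: output_diff_sqr_le PE QE t00 t10 t20.
apply: le_trans diff _.
have A1 : nu ^+ 2 * ((t1 + t2) * (t1 + t2)) <= nu ^+ 2 * (4 * (P + Q) * (t1 + t2)).
  by rewrite ler_wpM2l // ler_wpM2r //; lra.
have A2 : d ^+ 2 * (t0 * t0) <= d ^+ 2 * (t0 * (expR eps * (4 * (P + Q)))).
  rewrite ler_wpM2l // ler_wpM2l //; apply: le_trans t01 _; rewrite ler_wpM2l ?expR_ge0 //; lra.
have A3 : d ^+ 2 * (t2 * t2) <= d ^+ 2 * (t2 * (4 * (P + Q))).
  by rewrite ler_wpM2l // ler_wpM2l //; lra.
lra.
Qed.

(** Here [d * t0] is bounded by [P + Q] itself, being a summand of [Q], so the point 0 costs [2 d];
    the other terms are of order [rho] because [2 nu^2 <= rho]. *)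
Lemma lower_low_privacy (eps : R) n : testable p q eps n -> 1 <= n%:R * (14 * rho).
Proof.
case: params => rho0 rho1 nu0 nu1 nurho rhonu d0 d1 ab1 abnu.
move=> tst.
suff : 1 <= n%:R * (2 * d + 8 * nu ^+ 2 + (8 * nu ^+ 2 + 8 * d ^+ 2)).
  move=> /le_trans; apply; rewrite ler_wpM2l //.
  have : d ^+ 2 <= rho * 2^-1 by rewrite expr2 ler_pM; lra.
  lra.
have nn := sqr_ge0 nu; have dd := sqr_ge0 d.
apply: ternary_lower_bound tst; [lra|lra|lra|].
move=> t0 t1 t2 t00 t10 t20 t01 t02 t10' t12 t20' t21 P Q PE QE.
have PQ := output_sum_ge PE QE t00 t10 t20.
have dt0 : 0 <= d * t0 by rewrite mulr_ge0 //; lra.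
have PQ0 : 0 <= P + Q by lra.
apply: le_trans (output_diff_sqr_le PE QE t00 t10 t20) _.
have A1 : nu ^+ 2 * ((t1 + t2) * (t1 + t2)) <= nu ^+ 2 * (4 * (P + Q) * (t1 + t2)).
  by rewrite ler_wpM2l // ler_wpM2r //; lra.
have A2 : (d * t0) * (d * t0) <= (d * t0) * (P + Q) by rewrite ler_wpM2l //; lra.
have A3 : d ^+ 2 * (t2 * t2) <= d ^+ 2 * (t2 * (4 * (P + Q))).
  by rewrite ler_wpM2l // ler_wpM2l //; lra.
lra.
Qed.

(** * Upper bounds for the ternary pair by randomized response *)

(** Randomized response on the event {1}, whose masses [a] and [b] have sum 1 and difference
    [nu]. *)
Let testable_tv (eps : R) n : 0 < eps ->
  36 * (1 + expR eps) ^+ 2 <= n%:R * ((expR eps - 1) * nu) ^+ 2 -> testable p q eps n.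
Proof.
case: params => rho0 rho1 nu0 nu1 nurho rhonu d0 d1 ab1 abnu eps0 hn.
apply: (@testable_randomized_response _ _ p q (pred1 (inord 1)) eps n a b) => //.
- exact: left_pmf.
- exact: right_pmf.
- exact: left_neq_right.
- by rewrite big_pred1_eq /p /ternary inordK.
- by rewrite big_pred1_eq /q /ternary inordK.
by rewrite abnu ab1; move: hn; lra.
Qed.

(** Randomized response on the event {0}, of masses 0 and [d]. The constant is [36 * 3 * 32]: 3 from
    [1 + e <= 3 (e - 1)], and 32 from [e <= 2 (e - 1)] and [rho <= 4 d]. *)
Let testable_hellinger (eps : R) n : 2 <= expR eps ->
  24 * 144 * (2 + expR eps * rho) <= n%:R * (expR eps * rho ^+ 2) -> testable p q eps n.
Proof.
case: params => rho0 rho1 nu0 nu1 nurho rhonu d0 d1 ab1 abnu e2 hn.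
have eps0 : 0 < eps by rewrite -expR_gt1; lra.
apply: (@testable_randomized_response _ _ p q (pred1 (inord 0)) eps n 0 d) => //.
- exact: left_pmf.
- exact: right_pmf.
- exact: left_neq_right.
- by rewrite big_pred1_eq /p /ternary inordK.
- by rewrite big_pred1_eq /q /ternary inordK.
rewrite add0r sub0r mulrN sqrrN.
have n0 : 0 <= n%:R :> R by [].
move: (expR eps) (n%:R) n0 e2 hn => e m m0 e2 hn.
have d2 : rho ^+ 2 <= 16 * d ^+ 2 by nra.
have s1 : (e - 1) * d <= e * rho by apply: ler_pM; lra.
have s2 : e * rho ^+ 2 <= 32 * ((e - 1) * d ^+ 2).
  have : e * rho ^+ 2 <= (2 * (e - 1)) * (16 * d ^+ 2).
    by apply: ler_pM => //; [lra|exact: sqr_ge0|lra].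
  lra.
have s3 : 0 <= (e - 1) * d by rewrite mulr_ge0; lra.
have s4 : m * (e * rho ^+ 2) <= m * (32 * ((e - 1) * d ^+ 2)) by rewrite ler_wpM2l.
have s5 : 108 * (2 + (e - 1) * d) <= m * ((e - 1) * d ^+ 2) by lra.
apply: (@le_trans _ _ (108 * (2 + (e - 1) * d) * (e - 1))).
  have : (2 + (e - 1) * d) * (1 + e) <= (2 + (e - 1) * d) * (3 * (e - 1)).
    by rewrite ler_wpM2l; lra.
  lra.
have -> : m * ((e - 1) * d) ^+ 2 = m * ((e - 1) * d ^+ 2) * (e - 1) by ring.
by rewrite ler_wpM2r //; lra.
Qed.

Lemma upper_high_privacy (eps : R) n : 0 < eps ->
  72 * 144 * (1 / (eps ^+ 2 * nu ^+ 2)) <= n%:R -> eps <= 1 -> testable p q eps n.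
Proof.
case: (params) => rho0 rho1 nu0 nu1 nurho rhonu d0 d1 ab1 abnu eps0 hn eps1.
apply: testable_tv => //.
have [_ e4] := expR_sub1_le eps0 eps1; have e1 := expR_ge1Dx eps.
have en0 : 0 < eps ^+ 2 * nu ^+ 2 by rewrite mulr_gt0 ?exprn_gt0.
have {}hn : 72 * 144 <= n%:R * (eps ^+ 2 * nu ^+ 2).
  by rewrite -ler_pdivrMr //; move: hn; lra.
have e5 : (1 + expR eps) ^+ 2 <= 5 ^+ 2 by rewrite lerXn2r ?nnegrE; lra.
have en : eps * nu <= (expR eps - 1) * nu by rewrite ler_wpM2r; lra.
have {}en : (eps * nu) ^+ 2 <= ((expR eps - 1) * nu) ^+ 2.
  by rewrite lerXn2r // nnegrE mulr_ge0 //; lra.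
have : n%:R * (eps * nu) ^+ 2 <= n%:R * ((expR eps - 1) * nu) ^+ 2 by rewrite ler_wpM2l.
by rewrite exprMn; lra.
Qed.

(** The smaller term of the minimum decides which event is reported. As [exp eps * rho <= 1], one
    has [2 + exp eps * rho <= 3], whence [72 = 3 * 24]. *)
Lemma upper_moderate_privacy (eps : R) n : 0 < eps ->
  72 * 144 * Num.min (1 / nu ^+ 2) (1 / (expR eps * rho ^+ 2)) <= n%:R ->
  expR 1 <= expR eps -> expR eps <= 1 / rho -> testable p q eps n.
Proof.
case: (params) => rho0 rho1 nu0 nu1 nurho rhonu d0 d1 ab1 abnu eps0 hn e1 e2.
have e3 : 2 <= expR eps by apply: le_trans e1; apply: le_trans (expR_ge1Dx 1); lra.
have er : expR eps * rho <= 1 by rewrite -ler_pdivlMr.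
move: hn; case: (leP (1 / nu ^+ 2)) => _ hn.
  apply: testable_tv => //.
  have {}hn : 72 * 144 <= n%:R * nu ^+ 2.
    by rewrite -ler_pdivrMr ?exprn_gt0 //; move: hn; lra.
  apply: (@le_trans _ _ (36 * (3 * (expR eps - 1)) ^+ 2)).
    rewrite ler_wpM2l ?ler0n // lerXn2r ?nnegrE //; lra.
  have : 0 <= (expR eps - 1) ^+ 2 * (n%:R * nu ^+ 2 - 72 * 144).
    by rewrite mulr_ge0 ?sqr_ge0 // subr_ge0.
  by have := sqr_ge0 (expR eps - 1); lra.
apply: testable_hellinger => //.
have er0 : 0 < expR eps * rho ^+ 2 by rewrite mulr_gt0 ?exprn_gt0 ?expR_gt0.
have {}hn : 72 * 144 <= n%:R * (expR eps * rho ^+ 2).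
  by rewrite -ler_pdivrMr //; move: hn; lra.
lra.
Qed.

(** Now [exp eps * rho > 1], so [2 + exp eps * rho <= 3 * exp eps * rho], and the factor [exp eps]
    cancels from the condition. *)
Lemma upper_low_privacy (eps : R) n : 72 * 144 * (1 / rho) <= n%:R ->
  1 / rho < expR eps -> testable p q eps n.
Proof.
case: (params) => rho0 rho1 nu0 nu1 nurho rhonu d0 d1 ab1 abnu hn e1.
have er : 1 < expR eps * rho by rewrite -ltr_pdivrMr.
have e3 : 2 <= expR eps.
  have : expR eps * rho <= expR eps * 2^-1 by rewrite ler_wpM2l ?expR_ge0 // ltW.
  lra.
apply: testable_hellinger => //.
have {}hn : 72 * 144 <= n%:R * rho by rewrite -ler_pdivrMr //; move: hn; lra.
have : 72 * 144 * (expR eps * rho) <= n%:R * rho * (expR eps * rho).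
  by rewrite ler_wpM2r //; lra.
lra.
Qed.

End ternary_pair.

(** * From sufficient and necessary sizes to the sample complexity *)

Lemma sample_complexity_exists (R : realType) (X : finType) (p q : X -> R) eps m :
  testable p q eps m -> exists n, is_sample_complexity p q eps n.
Proof.
move=> tm; have ex : exists n, `[< testable p q eps n >] by exists m; exact/asboolP.
exists (ex_minn ex); case: ex_minnP => n /asboolP tn nmin; split=> // k /asboolP.
exact: nmin.
Qed.

Lemma truncnS_bounds (R : realType) (x : R) : 0 <= x ->
  x <= (Num.trunc x).+1%:R <= x + 1.
Proof.
move=> x0; have /andP[h1 h2] := truncn_itv x0.
by rewrite (ltW h2) /= -natr1 lerD2r.
Qed.

(** Rounding [K * B] up to an integer costs at most 1, which [B >= 1] absorbs into the constant
    [K + 1]. *)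
Lemma sample_complexity_asymp (R : realType) (X : finType) (p q : X -> R) eps n
    (K L B : R) :
  0 <= K -> 0 < L -> 1 <= B ->
  (forall m, K * B <= m%:R -> testable p q eps m) ->
  (testable p q eps n -> B <= L * n%:R) ->
  is_sample_complexity p q eps n -> asymp L^-1 (K + 1) n%:R B.
Proof.
move=> K0 L0 B1 up low [tn nmin]; split.
  by rewrite mulrC ler_pdivrMr // mulrC low.
have KB : 0 <= K * B by rewrite mulr_ge0 //; lra.
have /andP[h1 h2] := truncnS_bounds KB.
have := nmin _ (up _ h1); rewrite -(ler_nat R) => h3.
by rewrite mulrDl; lra.
Qed.

Theorem theorem1p7 (R : realType) :
  exists c1 c2 : R, [/\ 0 < c1, 0 < c2 &
    forall rho nu : R,
      0 < rho -> rho < 2^-1 -> 0 < nu -> nu < 2^-1 ->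
      2 * nu ^+ 2 <= rho -> rho <= nu ->
      exists p q : 'I_3 -> R,
        [/\ is_pmf p, is_pmf q, dh2 p q = rho, dTV p q = nu &
          forall eps : R, 0 < eps ->
            exists2 n : nat, is_sample_complexity p q eps n &
              [/\ eps <= 1 ->
                    asymp c1 c2 n%:R (1 / (eps ^+ 2 * dTV p q ^+ 2)),
                  expR 1 <= expR eps -> expR eps <= 1 / dh2 p q ->
                    asymp c1 c2 n%:R
                      (Num.min (1 / dTV p q ^+ 2)
                               (1 / (expR eps * dh2 p q ^+ 2)))
                & 1 / dh2 p q < expR eps ->
                    asymp c1 c2 n%:R (1 / dh2 p q)]]].
Proof.
(* The high privacy regime has the largest lower-bound constant; [72 * 144] suffices for all three
   upper bounds, and 1 pays for rounding. *)
exists (40 * 80)^-1, (72 * 144 + 1); split; [lra|lra|].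
move=> rho nu rho0 rho1 nu0 nu1 nurho rhonu.
have [d [d0 d1 dh]] := hellinger_solution rho0 rho1 nu0 nu1 nurho rhonu.
have params : pair_params rho nu d ((1 + nu) / 2) ((1 - nu) / 2).
  by split=> //; field.
move: ((1 + nu) / 2) ((1 - nu) / 2) params dh => a b params dh.
exists (ternary 0 a b), (ternary d b (a - d)).
have dh2E := dh2_ternary_pair params dh; have dTVE := dTV_ternary_pair params.
split=> //; [exact: left_pmf params|exact: right_pmf params|].
move=> eps eps0; rewrite dh2E dTVE.
have ex : exists m, testable (ternary 0 a b) (ternary d b (a - d)) eps m.
  have ub (x : R) : 0 <= x -> exists m : nat, x <= m%:R.
    by move=> x0; exists (Num.trunc x).+1; case/andP: (truncnS_bounds x0).
  have [eps1|eps1] := leP eps 1.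
    have [|m hm] := ub (72 * 144 * (1 / (eps ^+ 2 * nu ^+ 2))).
      by rewrite mulr_ge0 // divr_ge0 // mulr_ge0 // sqr_ge0.
    by exists m; exact: upper_high_privacy params _ _ eps0 hm eps1.
  have [er|er] := leP (expR eps) (1 / rho).
    have [|m hm] := ub (72 * 144 * Num.min (1 / nu ^+ 2) (1 / (expR eps * rho ^+ 2))).
      rewrite mulr_ge0 // le_min !divr_ge0 ?sqr_ge0 //.
      by rewrite mulr_ge0 ?expR_ge0 ?sqr_ge0.
    by exists m; apply: (upper_moderate_privacy params eps0 hm) => //; rewrite ler_expR ltW.
  have [|m hm] := ub (72 * 144 * (1 / rho)).
    by rewrite mulr_ge0 // divr_ge0 // ltW.
  by exists m; exact: upper_low_privacy params _ _ hm er.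
have [m tm] := ex; have [n nc] := sample_complexity_exists tm.
exists n => //.
have nu2 : 0 < nu ^+ 2 by rewrite exprn_gt0.
have n0 : 0 <= n%:R :> R by [].
(* The regimes may overlap, for instance when [eps <= 1] and [1 / rho < exp eps]; each estimate is
   proved for the same [n]. *)
split.
- move=> eps1; apply: sample_complexity_asymp nc; [lra|lra| | |].
  + rewrite ler_pdivlMr ?mulr_gt0 ?exprn_gt0 // mul1r -exprMn.
    by apply: exprn_ile1; [apply: mulr_ge0|apply: mulr_ile1]; lra.
  + by move=> k hk; exact: upper_high_privacy params _ _ eps0 hk eps1.
  + move=> tn; have := lower_high_privacy params eps0 eps1 tn.
    by rewrite ler_pdivrMr ?mulr_gt0 ?exprn_gt0 //; lra.
- move=> e1 er; have e0 := expR_gt0 eps.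
  have rho2 : 0 < rho ^+ 2 by rewrite exprn_gt0.
  have er1 : expR eps * rho <= 1 by rewrite -ler_pdivlMr.
  apply: sample_complexity_asymp nc; [lra|lra| | |].
  + rewrite le_min !ler_pdivlMr ?mulr_gt0 // !mul1r; apply/andP; split; first by nra.
    have : expR eps * rho * rho <= 1 * rho by rewrite ler_wpM2r // ltW.
    lra.
  + by move=> k hk; exact: upper_moderate_privacy params _ _ eps0 hk e1 er.
  + move=> tn.
    have e2 : 1 <= expR eps by rewrite -expR0 ler_expR ltW.
    have := lower_moderate_privacy params e2 tn.
    (* Multiplying the lower bound by [B] turns the sum of the two rates into a bound by their
       minimum: both [B * nu^2] and [B * exp eps * rho^2] are at most 1, so [B <= 32 n]. *)
    set B := Num.min _ _ => low.
    have B0 : 0 <= B by rewrite /B le_min !divr_ge0 ?mulr_ge0 ?ltW.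
    have B1 : B * nu ^+ 2 <= 1 by rewrite -ler_pdivlMr // /B ge_min lexx.
    have B2 : B * (expR eps * rho ^+ 2) <= 1.
      by rewrite -ler_pdivlMr ?mulr_gt0 // /B ge_min lexx orbT.
    have : B * 1 <= B * (n%:R * (16 * (nu ^+ 2 + expR eps * rho ^+ 2))).
      by rewrite ler_wpM2l.
    have : n%:R * (B * nu ^+ 2) <= n%:R * 1 by rewrite ler_wpM2l.
    have : n%:R * (B * (expR eps * rho ^+ 2)) <= n%:R * 1 by rewrite ler_wpM2l.
    lra.
- move=> er; apply: sample_complexity_asymp nc; [lra|lra| | |].
  + by rewrite ler_pdivlMr //; lra.
  + by move=> k hk; exact: upper_low_privacy params _ _ hk er.
  + move=> tn; have := lower_low_privacy params tn.
    have : 0 <= n%:R * rho by rewrite mulr_ge0 // ltW.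
    by rewrite ler_pdivrMr //; lra.
Qed.
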